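(* Assume that $\mathsf{X}$ is a Polish space. Assume: (A3) for all $\theta\in\Theta$, $P_\theta$ is $\pi$-irreducible and aperiodic, and there exist a function $V:\mathsf{X}\to[1,+\infty)$ and, for each $\theta\in\Theta$, constants $b_\theta<\infty$, $\delta_\theta\in(0,1)$, $\lambda_\theta\in(0,1)$ and a probability measure $\nu_\theta$ on $\mathsf{X}$ such that $$P_\theta V\le\lambda_\theta V+b_\theta,\qquad P_\theta(x,\cdot)\ge\delta_\theta\,\nu_\theta(\cdot)\,\mathbf{1}_{\{V\le c_\theta\}}(x),\qquad c_\theta=2b_\theta(1-\lambda_\theta)^{-1}-1;$$ (i) $\limsup_{n\to\infty}L_{\theta_n}<\infty$ $\mathbb{P}$-a.s.; (ii) for every bounded continuous $f:\mathsf{X}\to\mathbb{R}$, the class of functions $\{P_\theta f,\theta\in\Theta\}$ is equicontinuous; (iii) there exist $\theta_\star\in\Theta$ and, for every $x\in\mathsf{X}$, a $\mathbb{P}$-full set $\Omega_x$ such that for every $\omega\in\Omega_x$, $\{P_{\theta_n(\omega)}(x,\cdot),n\ge0\}$ converges weakly to $P_{\theta_\star}(x,\cdot)$. Then there exists a $\mathbb{P}$-full set $\Omega_0$ such that for every $\omega\in\Omega_0$ and every bounded continuous $f:\mathsf{X}\to\mathbb{R}$, $\pi_{\theta_n(\omega)}(f)\to\pi_{\theta_\star}(f)$ as $n\to\infty$ (equivalently, for every $\omega\in\Omega_0$, $\pi_{\theta_n(\omega)}$ converges weakly to $\pi_{\theta_\star}$).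
   Context: $(\Theta,\mathcal{T})$ is a measurable space, $\mathsf{X}$ carries its Borel $\sigma$-field $\mathcal{X}$, $\pi$ is a fixed (target) probability distribution on it, and $\{P_\theta,\theta\in\Theta\}$ is a collection of Markov transition kernels on $(\mathsf{X},\mathcal{X})$. $\{(X_n,\theta_n),n\ge0\}$ is an $\mathsf{X}\times\Theta$-valued process on a filtered probability space $(\Omega,\mathcal{A},\{\mathcal{F}_n\},\mathbb{P})$, $(X_n,\theta_n)$ is $\mathcal{F}_n$-adapted, and $\mathbb{E}[f(X_{n+1})\mid\mathcal{F}_n]=P_{\theta_n}f(X_n)$ for every bounded measurable $f$. A measurable set $A\in\mathcal{A}$ is $\mathbb{P}$-full if $\mathbb{P}(A)=1$. $\|\mu_1-\mu_2\|_V=\sup\{|\mu_1(f)-\mu_2(f)|:\sup_x|f(x)|/V(x)\le1\}$. Under (A3), each $P_\theta$ has a unique invariant probability $\pi_\theta$, and there are finite constants $C_\theta$ and $\rho_\theta\in(0,1)$ with $\|P_\theta^n(x,\cdot)-\pi_\theta\|_V\le C_\theta\rho_\theta^nV(x)$ for all $n\ge0$, $x\in\mathsf{X}$; such constants are fixed (they may be chosen so that $C_\theta\vee(1-\rho_\theta)^{-1}\le C\{b_\theta\vee\delta_\theta^{-1}\vee(1-\lambda_\theta)^{-1}\}^\gamma$ with $C,\gamma>0$ independent of $\theta$), and $L_\theta=C_\theta\vee(1-\rho_\theta)^{-1}$. *)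

(* Defs.v *)
From HB Require Import structures.
From mathcomp Require Import all_boot all_order all_algebra.
From mathcomp Require Import all_classical all_reals all_analysis.

Set Implicit Arguments.
Unset Strict Implicit.
Unset Printing Implicit Defensive.
Import Order.TTheory GRing.Theory Num.Theory.
Import numFieldTopology.Exports numFieldNormedType.Exports.

Local Open Scope classical_set_scope.
Local Open Scope ring_scope.

Notation borel X := (g_sigma_algebraType (@open X)).

(* Separable and completely metrizable. *)
Definition polish_space (R : realType) (X : topologicalType) : Prop :=
  (exists2 D : set X, countable D & dense D) /\
  exists dist : X -> X -> R,
    [/\ forall x y, dist x y = 0 <-> x = y,
        forall x y, dist x y = dist y x,
        forall x y z, dist x z <= dist x y + dist y z,
        forall (x : X) (A : set X), nbhs x A <->
          (exists2 e : R, 0 < e & [set y | dist x y < e] `<=` A)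
      & forall u : nat -> X,
          (forall e : R, 0 < e -> exists N : nat, forall m n : nat,
             (N <= m)%N -> (N <= n)%N -> dist (u m) (u n) < e) ->
          exists l : X, u @ \oo --> l].

Definition full_set (d : measure_display) (T : measurableType d)
    (R : realType) (Pr : probability T R) (A : set T) : Prop :=
  measurable A /\ Pr A = 1%E.

Section markov_kernels.
Context (d : measure_display) (T : measurableType d) (R : realType).
Implicit Types (K : R.-pker T ~> T).

Fixpoint kernel_iter K (n : nat) : R.-spker T ~> T :=
  if n is m.+1 then mkcomp_noparam K (kernel_iter K m)
  else kdirac (@measurable_id _ T setT).

(* (K f)(x); meant for bounded measurable f, since Rintegral is real-valued. *)
Definition kernel_act K (f : T -> R) (x : T) : R :=
  Rintegral (K x) setT f.

Definition irreducibility_measure K (phi : {measure set T -> \bar R}) : Prop :=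
  (0 < phi setT)%E /\
  forall (x : T) (A : set T), measurable A -> (0 < phi A)%E ->
    exists2 n : nat, (0 < n)%N & (0 < kernel_iter K n x A)%E.

Definition maximal_irreducibility_measure K
    (psi : {measure set T -> \bar R}) : Prop :=
  irreducibility_measure K psi /\
  forall phi : {measure set T -> \bar R}, irreducibility_measure K phi ->
    phi `<< psi.

(* Cycles, period and aperiodicity follow Meyn and Tweedie, Markov Chains and
   Stochastic Stability, Section 5.4.  [ordS] is the successor modulo p. *)
Definition has_cycle K (p : nat) : Prop :=
  (0 < p)%N /\
  exists psi : probability T R, exists D : 'I_p -> set T,
    [/\ maximal_irreducibility_measure K psi,
        forall i, measurable (D i),
        trivIset setT D,
        forall (i : 'I_p) (x : T), D i x -> K x (D (ordS i)) = 1%E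
      & psi (~` \bigcup_i D i) = 0%E].

Definition is_period K (p : nat) : Prop :=
  has_cycle K p /\ forall q : nat, has_cycle K q -> (q <= p)%N.

Definition aperiodic K : Prop := is_period K 1.

Definition invariant_measure K (mu : probability T R) : Prop :=
  forall A : set T, measurable A -> (\int[mu]_x K x A)%E = mu A.

(* The convention oo - oo = -oo of \bar R makes the distance infinite as soon
   as one of the differences is undefined. *)
Definition Vdist (V : T -> R) (mu1 mu2 : {measure set T -> \bar R}) : \bar R :=
  ereal_sup [set `|\int[mu1]_x (f x)%:E - \int[mu2]_x (f x)%:E|%E |
    f in [set f : T -> R | measurable_fun setT f /\
                           forall x, `|f x| / V x <= 1]].

End markov_kernels.

Section filtered_spaces.
Context (d : measure_display) (Om : measurableType d) (R : realType).

Definition filtration (F : nat -> set (set Om)) : Prop :=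
  [/\ forall n, sigma_algebra setT (F n),
      forall n, F n `<=` measurable
    & forall m n, (m <= n)%N -> F m `<=` F n].

Definition sub_measurable (G : set (set Om)) (d' : measure_display)
    (T : measurableType d') (Z : Om -> T) : Prop :=
  forall B : set T, measurable B -> G (Z @^-1` B).

(* Z is a version of the conditional expectation of Y given G. *)
Definition cond_expectation (Pr : probability Om R) (G : set (set Om))
    (Y Z : Om -> R) : Prop :=
  [/\ sub_measurable G Z,
      Pr.-integrable setT (EFin \o Z)
    & forall A : set Om, G A ->
        (\int[Pr]_(w in A) (Z w)%:E)%E = (\int[Pr]_(w in A) (Y w)%:E)%E].

End filtered_spaces.

Definition cvg_weakly (R : realType) (X : ptopologicalType)
    (mu_ : nat -> {measure set (borel X) -> \bar R})
    (mu : {measure set (borel X) -> \bar R}) : Prop :=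
  forall f : X -> R, continuous f -> bounded_fun f ->
    (fun n => Rintegral (mu_ n) setT f) @ \oo --> Rintegral mu setT f.

Section adaptive_chain.
Context (R : realType) (X : ptopologicalType).
Context (d : measure_display) (Theta : measurableType d).
Variable P : Theta -> R.-pker (borel X) ~> (borel X).

Definition adaptive_process (d' : measure_display) (Om : measurableType d')
    (Pr : probability Om R) (F : nat -> set (set Om))
    (Xn : nat -> Om -> borel X) (theta : nat -> Om -> Theta) : Prop :=
  [/\ filtration F,
      forall n, sub_measurable (F n) (fun w => (Xn n w, theta n w))
    & forall f : borel X -> R, measurable_fun setT f -> bounded_fun f ->
        forall n, cond_expectation Pr (F n) (fun w => f (Xn n.+1 w))
          (fun w => kernel_act (P (theta n w)) f (Xn n w))].

Definition minorization_level (b lambda : Theta -> R) (th : Theta) : R :=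
  2 * b th * (1 - lambda th)^-1 - 1.

Definition drift_minorization (pi : probability (borel X) R)
    (V : borel X -> R) (b delta lambda : Theta -> R)
    (nu : Theta -> probability (borel X) R) : Prop :=
  [/\ measurable_fun setT V,
      forall x, 1 <= V x
    & forall th,
      [/\ irreducibility_measure (P th) pi,
          aperiodic (P th),
          0 < delta th < 1,
          0 < lambda th < 1
        & (forall x, (\int[P th x]_y (V y)%:E <=
                      (lambda th * V x + b th)%:E)%E) /\
          (forall x (A : set (borel X)), measurable A ->
             ((delta th)%:E * nu th A *
                (\1_[set z | V z <= minorization_level b lambda th] x)%:E <=
              P th x A)%E)]].

(* C and rho are constants of V-uniform geometric ergodicity towards pi_. *)
Definition geometric_ergodicity (V : borel X -> R)
    (pi_ : Theta -> probability (borel X) R) (C rho : Theta -> R) : Prop :=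
  forall th, 0 < rho th < 1 /\
    forall n (x : borel X),
      (Vdist V (kernel_iter (P th) n x) (pi_ th) <=
       (C th * rho th ^+ n * V x)%:E)%E.

Definition ergodicity_constant (C rho : Theta -> R) (th : Theta) : R :=
  Num.max (C th) (1 - rho th)^-1.

End adaptive_chain.

(* Main.v *)
Require Import Defs.
From HB Require Import structures.
From mathcomp Require Import all_boot all_order all_algebra.
From mathcomp Require Import all_classical all_reals all_analysis.
From mathcomp Require Import measurable_realfun lra.
Import Order.TTheory GRing.Theory Num.Theory.
Import numFieldTopology.Exports numFieldNormedType.Exports.

(** Fix an outcome, write [P_n] and [P] for the kernels of [theta n] and
    [theta_star], [pi_n] and [pi] for their invariant laws, and let [f] be
    bounded and continuous. For any point [x] and any [k],
    [|pi_n f - pi f|] is at most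
      [|pi_n f - P_n^k f x| + |P_n^k f x - P^k f x| + |P^k f x - pi f|].
    Geometric ergodicity bounds the outer terms by [M * B * (1 - 1/B)^k * V x],
    where [B] bounds the ergodicity constants of [theta_star] and of [theta n]
    for all large [n]: such a [B] is what the limsup condition provides. So a
    single [k], chosen before [n], makes both outer terms small
    ([iter_kernel_invariant_dist]).

    It remains to see that [P_n^k f --> P^k f] pointwise for each fixed [k]
    ([iter_kernel_cvg]). This goes by induction on [k], through
      [P_n^(k+1) f - P^(k+1) f
         = P_n^k (P_n f - P f) + (P_n^k - P^k) (P f)].
    The last term is the induction hypothesis for [P f], which is continuous by
    equicontinuity. In the first term, [|P_n f - P f|] is below
    [h_m := sup_(n >= m) |P_n f - P f|] as soon as [n >= m]; equicontinuity makes
    [h_m] continuous, so that the induction hypothesis applies to it too and the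
    limit superior of the first term is at most [P^k h_m x], for every [m].
    Since [h_m] decreases to [0] pointwise, dominated convergence sends this
    bound to [0]. The fixed functions [h_m] thus play the part of uniform
    convergence on compact sets combined with tightness.

    Separability yields the full set. Almost surely the weak convergence holds
    at all points of a countable dense set at once, and equicontinuity carries
    it to all points ([equicontinuous_cvg_dense]). *)

Set Implicit Arguments.
Unset Strict Implicit.
Unset Printing Implicit Defensive.

Local Open Scope classical_set_scope.
Local Open Scope ring_scope.

(** * The action of a Markov kernel on bounded measurable functions *)

Lemma bounded_funE (T : Type) (R : realType) (f : T -> R) :
  bounded_fun f <-> exists M : R, forall x, `|f x| <= M.
Proof.
split=> [[M [_ fM]]|[M fM]].
  by exists (M + 1) => x; apply: fM => //; rewrite ltrDl.
exists M; split; first exact: num_real.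
by move=> N MN x _; apply: le_trans (fM x) (ltW MN).
Qed.

Section kernel_act_theory.
Context {d : measure_display} {T : measurableType d} {R : realType}.
Implicit Types (K : R.-pker T ~> T) (f g h : T -> R).

Definition bounded_measurable f := measurable_fun [set: T] f /\ bounded_fun f.

Lemma bounded_measurable_cst (c : R) : bounded_measurable (fun=> c).
Proof. by split; [exact: measurable_cst|apply/bounded_funE; exists `|c|]. Qed.

Lemma bounded_measurableD f g : bounded_measurable f -> bounded_measurable g ->
  bounded_measurable (fun x => f x + g x).
Proof.
move=> [mf /bounded_funE[M fM]] [mg /bounded_funE[N gN]]; split.
  exact: measurable_funD.
apply/bounded_funE; exists (M + N) => x.
by rewrite (le_trans (ler_normD _ _))// lerD.
Qed.

Lemma bounded_measurableB f g : bounded_measurable f -> bounded_measurable g ->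
  bounded_measurable (fun x => f x - g x).
Proof.
move=> [mf /bounded_funE[M fM]] [mg /bounded_funE[N gN]]; split.
  exact: measurable_funB.
apply/bounded_funE; exists (M + N) => x.
by rewrite (le_trans (ler_normB _ _))// lerD.
Qed.

Lemma bounded_measurable_norm f : bounded_measurable f ->
  bounded_measurable (fun x => `|f x|).
Proof.
move=> [mf /bounded_funE[M fM]]; split; first exact: measurableT_comp.
by apply/bounded_funE; exists M => x; rewrite normr_id.
Qed.

Lemma bounded_measurable_integrable (mu : {measure set T -> \bar R}) f :
  (mu setT < +oo)%E -> bounded_measurable f ->
  mu.-integrable setT (EFin \o f).
Proof. by move=> mufin [mf bf]; exact: measurable_bounded_integrable. Qed.

Lemma kernel_act_integrable K f x : bounded_measurable f ->
  (K x).-integrable setT (EFin \o f).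
Proof.
by apply: bounded_measurable_integrable; rewrite prob_kernel ltry.
Qed.

Lemma kernel_act_cst K (c : R) x : kernel_act K (fun=> c) x = c.
Proof. by rewrite /kernel_act Rintegral_cst// prob_kernel mulr1. Qed.

Lemma kernel_actD K f g x : bounded_measurable f -> bounded_measurable g ->
  kernel_act K (fun y => f y + g y) x = kernel_act K f x + kernel_act K g x.
Proof. by move=> bf bg; apply: RintegralD => //; exact: kernel_act_integrable. Qed.

Lemma kernel_actB K f g x : bounded_measurable f -> bounded_measurable g ->
  kernel_act K (fun y => f y - g y) x = kernel_act K f x - kernel_act K g x.
Proof. by move=> bf bg; apply: RintegralB => //; exact: kernel_act_integrable. Qed.

(** Positivity of [K], in the form in which it is iterated below. *)
Lemma kernel_act_dist_le K f g h x :
  bounded_measurable f -> bounded_measurable g -> bounded_measurable h ->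
  (forall y, `|f y - g y| <= h y) ->
  `|kernel_act K f x - kernel_act K g x| <= kernel_act K h x.
Proof.
move=> bf bg bh fgh; rewrite -kernel_actB//.
have bfg := bounded_measurableB bf bg.
apply: (le_trans (le_normr_Rintegral measurableT (kernel_act_integrable K x bfg))).
by apply: le_Rintegral => //; apply: kernel_act_integrable => //;
  exact: bounded_measurable_norm.
Qed.

Lemma kernel_act_bound K f (M : R) x : bounded_measurable f ->
  (forall y, `|f y| <= M) -> `|kernel_act K f x| <= M.
Proof.
move=> bf fM.
have := kernel_act_dist_le K (f := f) (g := cst 0) (h := cst M) x bf
  (bounded_measurable_cst 0) (bounded_measurable_cst M).
rewrite !kernel_act_cst subr0; apply.
by move=> y; rewrite subr0.
Qed.

(** Integrals against a kernel depend measurably on its first argument for a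
    nonnegative integrand; a bounded [f] reduces to [f + M >= 0], because [K]
    preserves constants. *)
Lemma bounded_measurable_act K f : bounded_measurable f ->
  bounded_measurable (kernel_act K f).
Proof.
move=> bf; have [mf /bounded_funE[M fM]] := bf; split; last first.
  by apply/bounded_funE; exists M => x; exact: kernel_act_bound.
have bg := bounded_measurableD bf (bounded_measurable_cst M).
have -> : kernel_act K f = fun x => kernel_act K (fun y => f y + M) x - M.
  apply/funext => x; rewrite kernel_actD ?kernel_act_cst ?addrK//.
  exact: bounded_measurable_cst.
apply: measurable_funB; last exact: measurable_cst.
apply: (measurableT_comp (@fine_measurable _ setT measurableT)).
apply: measurable_fun_integral_kernel.
- by move=> U mU; exact: measurable_kernel.
- by move=> y; rewrite lee_fin -lerBlDr sub0r lerNnormlW.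
- by apply/measurable_EFinP; case: bg.
Qed.

Lemma bounded_measurable_iter K n f : bounded_measurable f ->
  bounded_measurable (iter n (kernel_act K) f).
Proof. by move=> bf; elim: n => //= n; exact: bounded_measurable_act. Qed.

Lemma kernel_act_cvg K (f_ : nat -> T -> R) f (M : R) x :
  (forall n, bounded_measurable (f_ n)) -> bounded_measurable f ->
  (forall n y, `|f_ n y| <= M) ->
  (forall y, f_ n y @[n --> \oo] --> f y) ->
  kernel_act K (f_ n) x @[n --> \oo] --> kernel_act K f x.
Proof.
move=> bf_ bf f_M f_f.
have [] := @dominated_convergence _ _ _ (K x) setT measurableT
  (fun n => EFin \o f_ n) (EFin \o f) (EFin \o fun=> M).
- by move=> n; apply/measurable_EFinP; case: (bf_ n).
- by apply/measurable_EFinP; case: bf.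
- by apply: aeW => y _ /=; apply: cvg_EFin; [exact: nearW|exact: f_f].
- exact: kernel_act_integrable (bounded_measurable_cst M).
- by apply: aeW => y n _ /=; rewrite lee_fin.
move=> intf _ cvgf; apply: fine_cvg.
by rewrite fineK//; exact: integrable_fin_num.
Qed.

(** The composition of [k1] and [k2] is the parametrized composition in which
    the second kernel ignores the starting point, and the integral formula for
    the latter applies. *)
Lemma ge0_integral_mkcomp_noparam (k1 k2 : R.-spker T ~> T) x (f : T -> \bar R) :
  (forall y, (0 <= f y)%E) -> measurable_fun setT f ->
  (\int[mkcomp_noparam k1 k2 x]_y f y = \int[k1 x]_y \int[k2 y]_z f z)%E.
Proof.
move=> f0 mf.
exact: (integral_kcomp k1 (kernel.kernel_snd k2)).
Qed.

Lemma kernel_iter_lty K n x : ((kernel_iter K n x setT) < +oo)%E.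
Proof. exact: le_lt_trans (sprob_kernel_le1 _ _) (ltry _). Qed.

Let ge0_kernel_iterE K n f x : bounded_measurable f -> (forall y, 0 <= f y) ->
  (\int[kernel_iter K n x]_y (f y)%:E = (iter n (kernel_act K) f x)%:E)%E.
Proof.
move=> bf f0; have mf : measurable_fun setT (EFin \o f).
  by apply/measurable_EFinP; case: bf.
elim: n x => [|n IHn] x.
  rewrite /= (@integral_dirac _ T x R setT measurableT (EFin \o f) mf).
  by rewrite diracT mul1e.
rewrite [kernel_iter _ _]/= ge0_integral_mkcomp_noparam//.
under eq_integral do rewrite IHn.
rewrite /= /kernel_act/Rintegral fineK//.
apply: integrable_fin_num => //; apply: kernel_act_integrable.
exact: bounded_measurable_iter.
Qed.

Lemma iter_kernel_actD K n f g x : bounded_measurable f -> bounded_measurable g ->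
  iter n (kernel_act K) (fun y => f y + g y) x =
  iter n (kernel_act K) f x + iter n (kernel_act K) g x.
Proof.
move=> bf bg; elim: n x => //= n IHn x.
rewrite -kernel_actD; [|exact: bounded_measurable_iter..].
by congr kernel_act; apply/funext.
Qed.

(** The formula propagates along the iteration for nonnegative functions, by
    the integral formula for compositions. It is then applied to [f + M] and to
    the constant [M], whose difference is taken on both sides. *)
Lemma kernel_iterE K n f x : bounded_measurable f ->
  Rintegral (kernel_iter K n x) setT f = iter n (kernel_act K) f x.
Proof.
move=> bf; have [mf /bounded_funE[M fM]] := bf.
have bM := bounded_measurable_cst M.
have bfM := bounded_measurableD bf bM.
have M0 (y : T) : 0 <= M by exact: le_trans (normr_ge0 _) (fM y).
have fM0 y : 0 <= f y + M by rewrite -lerBlDr sub0r lerNnormlW.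
have fin := bounded_measurable_integrable (kernel_iter_lty K n x).
have intE g : bounded_measurable g -> (forall y, 0 <= g y) ->
    Rintegral (kernel_iter K n x) setT g = iter n (kernel_act K) g x.
  by move=> bg g0; rewrite /Rintegral ge0_kernel_iterE.
have := intE _ bfM fM0.
rewrite (RintegralD measurableT (fin _ bf) (fin _ bM)) iter_kernel_actD//.
by rewrite (intE _ bM) => [/addIr|y]; last exact: M0 y.
Qed.

Lemma iter_kernel_act_dist_le K n f g h x :
  bounded_measurable f -> bounded_measurable g -> bounded_measurable h ->
  (forall y, `|f y - g y| <= h y) ->
  `|iter n (kernel_act K) f x - iter n (kernel_act K) g x| <=
  iter n (kernel_act K) h x.
Proof.
move=> bf bg bh fgh; elim: n x => //= n IHn x.
by apply: kernel_act_dist_le => //; exact: bounded_measurable_iter.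
Qed.

Lemma iter_kernel_act_bound K n f (M : R) x : bounded_measurable f ->
  (forall y, `|f y| <= M) -> `|iter n (kernel_act K) f x| <= M.
Proof.
move=> bf fM; elim: n x => //= n IHn x.
by apply: kernel_act_bound => //; exact: bounded_measurable_iter.
Qed.

Lemma iter_kernel_act_cvg K n (f_ : nat -> T -> R) f (M : R) x :
  (forall m, bounded_measurable (f_ m)) -> bounded_measurable f ->
  (forall m y, `|f_ m y| <= M) ->
  (forall y, f_ m y @[m --> \oo] --> f y) ->
  iter n (kernel_act K) (f_ m) x @[m --> \oo] --> iter n (kernel_act K) f x.
Proof.
move=> bf_ bf f_M f_f; elim: n x => //= n IHn x.
apply: (kernel_act_cvg (M := M)) => //.
- by move=> m; exact: bounded_measurable_iter.
- exact: bounded_measurable_iter.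
- by move=> m y; exact: iter_kernel_act_bound.
Qed.

Lemma iter_kernel_act_cst K n (c : R) :
  iter n (kernel_act K) (fun=> c) = fun=> c.
Proof.
by elim: n => //= n ->; apply/funext => x; rewrite kernel_act_cst.
Qed.

(** The functions tested by the [V]-distance are those dominated by [V];
    as [V >= 1], they contain [M^-1 * f] whenever [|f| <= M]. *)
Lemma Vdist_bound (V : T -> R) (mu1 mu2 : {measure set T -> \bar R}) f (M c : R) :
  (forall x, 1 <= V x) -> (mu1 setT < +oo)%E -> (mu2 setT < +oo)%E ->
  (Vdist V mu1 mu2 <= c%:E)%E ->
  bounded_measurable f -> 0 < M -> (forall x, `|f x| <= M) ->
  `|Rintegral mu1 setT f - Rintegral mu2 setT f| <= M * c.
Proof.
move=> V1 fin1 fin2 Vc bf M0 fM.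
have [mf _] := bf.
have bg : bounded_measurable (fun x => M^-1 * f x).
  split; first exact: measurable_funM.
  apply/bounded_funE; exists 1 => x.
  by rewrite normrM gtr0_norm ?invr_gt0// mulrC ler_pdivrMr// mul1r.
have i1 := bounded_measurable_integrable fin1 bf.
have i2 := bounded_measurable_integrable fin2 bf.
have j1 := bounded_measurable_integrable fin1 bg.
have j2 := bounded_measurable_integrable fin2 bg.
have : (`|(Rintegral mu1 setT (fun x => M^-1 * f x) -
          Rintegral mu2 setT (fun x => M^-1 * f x))%:E| <= c%:E)%E.
  apply: le_trans Vc; apply: ereal_sup_ubound.
  exists (fun x => M^-1 * f x).
    split; first by case: bg.
    move=> x; have V0 : 0 < V x by exact: lt_le_trans (V1 x).
    rewrite ler_pdivrMr// mul1r (le_trans _ (V1 x))//.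
    by rewrite normrM gtr0_norm ?invr_gt0// mulrC ler_pdivrMr// mul1r.
  by rewrite EFinB /Rintegral !fineK//; exact: integrable_fin_num.
rewrite !RintegralZl// lee_fin -mulrBr normrM gtr0_norm ?invr_gt0//.
by rewrite mulrC ler_pdivrMr// mulrC.
Qed.

End kernel_act_theory.

(** * Equicontinuous families of functions *)

Section bounded_continuous.
Context {R : realType} {X : ptopologicalType}.
Implicit Types (f g : X -> R).

Definition bounded_continuous f := continuous f /\ bounded_fun f.

Lemma continuous_borel_measurable f :
  continuous f -> measurable_fun [set: borel X] (f : borel X -> R).
Proof.
move=> /continuousP cf; apply: (measurability _ (RGenOpens.measurableE R)).
move=> _ [_ [a [b ->] <-]]; rewrite setTI; apply: sub_sigma_algebra.
exact/cf/interval_open.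
Qed.

Lemma bounded_continuous_measurable f :
  bounded_continuous f -> bounded_measurable (f : borel X -> R).
Proof. by move=> [cf bf]; split=> //; exact: continuous_borel_measurable. Qed.

Lemma equicontinuous_dist (I : Type) (F : I -> X -> R) :
  equicontinuous [set: I] F <->
  forall x (e : R), 0 < e -> \forall y \near x, forall i, `|F i x - F i y| < e.
Proof.
split=> [eF x e e0|eF x E].
  have := eF x _ (entourage_ball R (PosNum e0)).
  apply: filterS => y Fy i; have := Fy i Logic.I.
  by rewrite /= -ball_normE.
rewrite -entourage_from_ballE => -[e /= e0 eE].
apply: filterS (eF x e e0) => y Fy i _; apply: eE.
by rewrite /= -ball_normE; exact: Fy.
Qed.

Lemma equicontinuous_continuous (I : Type) (F : I -> X -> R) i :
  equicontinuous [set: I] F -> continuous (F i).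
Proof.
move=> /equicontinuous_dist eF x; apply/cvgrPdist_lt => e e0.
by apply: filterS (eF x e e0) => y; exact.
Qed.

(** Three-epsilon argument: near [x] all the [F j], including the limit [F i],
    vary by less than [e / 3], and a point of [D] lies there. *)
Lemma equicontinuous_cvg_dense (I : Type) (F : I -> X -> R) (u : nat -> I)
    (i : I) (D : set X) :
  equicontinuous [set: I] F -> dense D ->
  (forall x, D x -> F (u n) x @[n --> \oo] --> F i x) ->
  forall x, F (u n) x @[n --> \oo] --> F i x.
Proof.
move=> /equicontinuous_dist eF dD FD x; apply/cvgrPdist_lt => e e0.
have e30 : 0 < e / 3 by rewrite divr_gt0.
have : nbhs x [set y | forall j, `|F j x - F j y| < e / 3] := eF x _ e30.
rewrite nbhsE => -[U [oU Ux] UF].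
have [y [Uy Dy]] := dD U (ex_intro _ x Ux) oU.
have /cvgrPdist_lt/(_ _ e30) := FD y Dy.
apply: filterS => n Fny.
have := UF y Uy i; have := UF y Uy (u n).
move: Fny; rewrite !ltr_norml => /andP[? ?] /andP[? ?] /andP[? ?]; lra.
Qed.

(** The suprema [sup_(n >= m) |g n|] of an equicontinuous sequence inherit its
    modulus of continuity, hence are continuous, and they vanish as [m] grows
    where [g n] does. They trade a varying integrand for a fixed one. *)
Section tail_sup.
Variables (g : nat -> X -> R) (M : R).
Hypotheses (eg : equicontinuous [set: nat] g) (gM : forall n x, `|g n x| <= M).

Definition tail_sup m x : R := sups (fun n => `|g n x|) m.

Lemma tail_sup_ge m n x : (m <= n)%N -> `|g n x| <= tail_sup m x.
Proof.
move=> mn; apply: ub_le_sup; last by exists n.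
by exists M => _ [k _ <-].
Qed.

Lemma tail_sup_le m x (c : R) :
  (forall n, (m <= n)%N -> `|g n x| <= c) -> tail_sup m x <= c.
Proof.
move=> gc; apply: ge_sup; first by exists `|g m x|, m => //=.
by move=> _ [n /= mn <-]; exact: gc.
Qed.

Lemma tail_sup_bound m x : `|tail_sup m x| <= M.
Proof.
rewrite ger0_norm; first by apply: tail_sup_le.
exact: le_trans (tail_sup_ge x (leqnn m)).
Qed.

Lemma tail_sup_le_dist m x y (e : R) :
  (forall n, `|g n x - g n y| < e) -> tail_sup m x <= tail_sup m y + e.
Proof.
move=> gxy; apply: tail_sup_le => n mn.
rewrite -(subrK (g n y) (g n x)) addrC (le_trans (ler_normD _ _))//.
by rewrite lerD ?tail_sup_ge// ltW.
Qed.

Lemma bounded_continuous_tail_sup m : bounded_continuous (tail_sup m).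
Proof.
split; last by apply/bounded_funE; exists M => x; exact: tail_sup_bound.
move=> x; apply/cvgrPdist_le => e e0.
have := (equicontinuous_dist g).1 eg x e e0; apply: filterS => y gxy.
rewrite ler_distlC lerBlDr; apply/andP; split; apply: tail_sup_le_dist => // n.
by rewrite distrC.
Qed.

Lemma tail_sup_cvg0 x :
  g n x @[n --> \oo] --> 0 -> tail_sup m x @[m --> \oo] --> 0.
Proof.
move=> /cvgrPdist_le gx; apply/cvgrPdist_le => e e0.
have [N _ gN] := gx e e0; exists N => // m /= Nm.
rewrite sub0r normrN ger0_norm; last first.
  exact: le_trans (tail_sup_ge x (leqnn m)).
apply: tail_sup_le => n mn; have := gN n (leq_trans Nm mn).
by rewrite sub0r normrN.
Qed.

End tail_sup.
End bounded_continuous.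

(** * Convergence of the iterated kernels *)

Section iterates.
Context {R : realType} {X : ptopologicalType} {I : Type}.
Variable P : I -> R.-pker (borel X) ~> (borel X).
Hypothesis eP : forall f : X -> R, bounded_continuous f ->
  equicontinuous [set: I] (fun i => kernel_act (P i) f : X -> R).

Lemma bounded_continuous_act i (f : X -> R) :
  bounded_continuous f -> bounded_continuous (kernel_act (P i) f : X -> R).
Proof.
move=> bf; split; first exact:
    (@equicontinuous_continuous R X I (fun i => kernel_act (P i) f) i (eP bf)).
by have [] := bounded_measurable_act (P i) (bounded_continuous_measurable bf).
Qed.

(** Weak convergence of the kernels passes to their iterates. The induction
    runs over all bounded continuous functions, as it is used for [P f] and for
    the tail suprema of [P_n f - P f]. *)
Lemma iter_kernel_cvg (u : nat -> I) (i : I) :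
  (forall f : X -> R, bounded_continuous f -> forall x : X,
    kernel_act (P (u n)) f x @[n --> \oo] --> kernel_act (P i) f x) ->
  forall k (f : X -> R), bounded_continuous f -> forall x : X,
    iter k (kernel_act (P (u n))) f x @[n --> \oo] -->
    iter k (kernel_act (P i)) f x.
Proof.
move=> Pu; elim=> [|k IHk] f bf x; first exact: cvg_cst.
have [_ /bounded_funE[M fM]] := bf.
have mf := bounded_continuous_measurable bf.
pose g n (y : X) : R := kernel_act (P (u n)) f y - kernel_act (P i) f y.
have gM n y : `|g n y| <= M + M.
  by rewrite (le_trans (ler_normB _ _))// lerD// kernel_act_bound.
have eg : equicontinuous [set: nat] g.
  apply/equicontinuous_dist => y e e0; have e20 : 0 < e / 2 by rewrite divr_gt0.
  have := (equicontinuous_dist _).1 (eP bf) y _ e20; apply: filterS => z Pyz n.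
  have := Pyz (u n); have := Pyz i; rewrite /g !ltr_norml.
  by move=> /andP[? ?] /andP[? ?]; lra.
have g0 y : g n y @[n --> \oo] --> (0 : R).
  rewrite -(subrr (kernel_act (P i) f y)); apply: cvgB; last exact: cvg_cst.
  exact: Pu.
pose h := tail_sup g.
have bh m : bounded_continuous (h m) := bounded_continuous_tail_sup eg gM m.
have mh m := bounded_continuous_measurable (bh m).
(* Dominated convergence, for the fixed limit kernel. *)
have h0 : iter k (kernel_act (P i)) (h m) x @[m --> \oo] --> (0 : R).
  rewrite -[X in _ --> X](congr1 (@^~ x) (iter_kernel_act_cst (P i) k 0)).
  apply: (iter_kernel_act_cvg (M := M + M)) => //.
  - exact: bounded_measurable_cst.
  - by move=> m y; exact: tail_sup_bound.
  - by move=> y; exact: tail_sup_cvg0.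
apply/cvgrPdist_lt => e e0; have e30 : 0 < e / 3 by rewrite divr_gt0.
have [m _ /(_ m (leqnn m)) hm] := (cvgrPdist_lt _ _).1 h0 _ e30.
have cvg1 := (cvgrPdist_lt _ _).1 (IHk _ (bh m) x) _ e30.
have cvg2 := (cvgrPdist_lt _ _).1 (IHk _ (bounded_continuous_act i bf) x) _ e30.
(* Innermost action first, so that [P_n f] and [P f] are compared before the
   remaining [k] steps are taken. *)
near=> n; rewrite !iterSr.
have dom : `|iter k (kernel_act (P (u n))) (kernel_act (P (u n)) f) x -
    iter k (kernel_act (P (u n))) (kernel_act (P i) f) x| <=
    iter k (kernel_act (P (u n))) (h m) x.
  apply: iter_kernel_act_dist_le => //; try exact: bounded_measurable_act.
  by move=> y; apply: (tail_sup_ge gM); near: n; exact: nbhs_infty_ge.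
have c1 : `|iter k (kernel_act (P i)) (h m) x -
    iter k (kernel_act (P (u n))) (h m) x| < e / 3 by near: n; exact: cvg1.
have c2 : `|iter k (kernel_act (P i)) (kernel_act (P i) f) x -
    iter k (kernel_act (P (u n))) (kernel_act (P i) f) x| < e / 3.
  by near: n; exact: cvg2.
move: dom c1 c2 hm; rewrite sub0r normrN ler_norml !ltr_norml.
move=> /andP[? ?] /andP[? ?] /andP[? ?] /andP[? ?]; lra.
Unshelve. all: by end_near. Qed.

End iterates.

(** * Almost sure statements *)

Lemma full_set_ae {d : measure_display} {T : measurableType d} {R : realType}
    (Pr : probability T R) (A : set T) :
  full_set Pr A -> {ae Pr, forall w, A w}.
Proof.
move=> [mA PA]; exists (~` A); split => //; first exact: measurableC.
by rewrite probability_setC// PA subee.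
Qed.

Lemma ae_full_set {d : measure_display} {T : measurableType d} {R : realType}
    (Pr : probability T R) (Q : T -> Prop) :
  {ae Pr, forall w, Q w} -> exists2 A, full_set Pr A & A `<=` Q.
Proof.
move=> [N [mN PN QN]]; exists (~` N); last by move=> w; apply: contra_notP => /QN.
by split; [exact: measurableC|rewrite probability_setC// PN sube0].
Qed.

(** A countable set is indexed by an injection [r] into [nat]; the level sets of
    [r] have at most one point, which reduces the claim to countable
    intersections over [nat]. *)
Lemma ae_countable {d : measure_display} {T : measurableType d} {R : realType}
    (Pr : probability T R) (S : Type) (D : set S) (Q : S -> T -> Prop) :
  countable D -> (forall x, D x -> {ae Pr, forall w, Q x w}) ->
  {ae Pr, forall w x, D x -> Q x w}.
Proof.
move=> /countable_injP[r rinj] aeQ.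
have /ae_foralln : forall n, {ae Pr, forall w x, D x -> r x = n -> Q x w}.
  move=> n; have [[x [Dx rxn]]|nD] := pselect (exists x, D x /\ r x = n).
    apply: filterS (aeQ x Dx) => w Qxw y Dy ryn.
    by rewrite (rinj y x) ?inE// rxn.
  by apply: aeW => w x Dx rxn; case: nD; exists x.
by apply: filterS => w Qw x Dx; exact: Qw Dx erefl.
Qed.

(** The limsup is the infimum, over the neighbourhoods of infinity, of the
    suprema of [u] on them; one of these suprema is therefore finite. *)
Lemma limn_esup_lt_pinfty_bound {R : realType} (u : nat -> R) :
  (limn_esup (fun n => (u n)%:E) < +oo)%E ->
  exists B, \forall n \near \oo, u n <= B.
Proof.
move=> /ereal_inf_lt[_ [A /= Aoo <-]] supA.
exists (fine (ereal_sup [set (u n)%:E | n in A])).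
apply: filterS Aoo => n An.
have : ((u n)%:E <= ereal_sup [set (u n)%:E | n in A])%E.
  by apply: ereal_sup_ubound; exists n.
by move: supA; case: ereal_sup => [s| |]//=; rewrite lee_fin.
Qed.

(** * Uniform geometric rate and convergence of the invariant laws *)

Section rate.
Context {R : realType}.
Context {dT : measure_display} {Theta : measurableType dT}.

(** A single [B] gives a rate common to all [th] whose ergodicity constant it
    bounds: [(1 - rho)^-1 <= B] means [rho <= 1 - B^-1]. *)
Lemma ergodicity_constant_rate (C rho : Theta -> R) th (B : R) (k : nat) (V : R) :
  0 < rho th < 1 -> ergodicity_constant C rho th <= B -> 0 <= V ->
  C th * rho th ^+ k * V <= B * (1 - B^-1) ^+ k * V.
Proof.
move=> /andP[rho0 rho1]; rewrite /ergodicity_constant ge_max => /andP[CB rhoB] V0.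
have rho10 : 0 < 1 - rho th by rewrite subr_gt0.
have B0 : 0 < B by apply: lt_le_trans rhoB; rewrite invr_gt0.
have rho_le : rho th <= 1 - B^-1.
  by rewrite lerBrDr addrC -lerBrDr -(invrK (1 - _)) lef_pV2 ?posrE ?invr_gt0.
apply: ler_wpM2r => //.
apply: (@le_trans _ _ (B * rho th ^+ k)); first by rewrite ler_wpM2r// exprn_ge0// ltW.
rewrite ler_wpM2l ?(ltW B0)//; apply: (lerXn2r _ _ _ rho_le); rewrite nnegrE ltW//.
exact: lt_le_trans rho_le.
Qed.

Lemma ergodicity_constant_gt1 (C rho : Theta -> R) th :
  0 < rho th < 1 -> 1 < ergodicity_constant C rho th.
Proof.
move=> /andP[rho0 rho1]; rewrite /ergodicity_constant lt_max; apply/orP; right.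
by rewrite invf_gt1 ?subr_gt0// gtrBl.
Qed.

End rate.

Section invariant_laws.
Context {R : realType} {X : ptopologicalType}.
Context {dT : measure_display} {Theta : measurableType dT}.
Variables (P : Theta -> R.-pker (borel X) ~> (borel X)) (V : borel X -> R).
Variables (pi_ : Theta -> probability (borel X) R) (C rho : Theta -> R).
Hypothesis V1 : forall x, 1 <= V x.
Hypothesis ergP : geometric_ergodicity P V pi_ C rho.

Lemma iter_kernel_invariant_dist th (B M : R) k (f : borel X -> R) x :
  ergodicity_constant C rho th <= B ->
  bounded_measurable f -> 0 < M -> (forall y, `|f y| <= M) ->
  `|iter k (kernel_act (P th)) f x - Rintegral (pi_ th) setT f| <=
  M * (B * (1 - B^-1) ^+ k * V x).
Proof.
move=> LB bf M0 fM; have [rho01 Vk] := ergP th.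
have V0 : 0 <= V x by exact: le_trans (V1 x).
rewrite -kernel_iterE//.
apply: (@le_trans _ _ (M * (C th * rho th ^+ k * V x))); last first.
  by rewrite ler_wpM2l ?(ltW M0)//; exact: ergodicity_constant_rate.
apply: (Vdist_bound (V := V)) => //; first exact: kernel_iter_lty.
by rewrite (le_lt_trans (probability_le1 _ measurableT)) ?ltry.
Qed.

(** The part of the argument in which nothing is random: [u] is one realization
    of the parameter process. *)
Lemma invariant_cvg_weakly (u : nat -> Theta) (th : Theta) :
  (forall f : X -> R, bounded_continuous f ->
    equicontinuous [set: Theta] (fun i => kernel_act (P i) f : X -> R)) ->
  (limn_esup (fun n => (ergodicity_constant C rho (u n))%:E) < +oo)%E ->
  (forall f : X -> R, bounded_continuous f -> forall x : X,
    kernel_act (P (u n)) f x @[n --> \oo] --> kernel_act (P th) f x) ->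
  cvg_weakly (fun n => pi_ (u n)) (pi_ th).
Proof.
move=> eP /limn_esup_lt_pinfty_bound[B0 uB0] Pu f cf bf.
have cbf : bounded_continuous f by [].
have mf := bounded_continuous_measurable cbf.
have [M0 fM0] := (bounded_funE f).1 bf.
(* [M] must be positive, to normalise [f]; [B] also covers the limit kernel. *)
pose M := Num.max M0 1; pose B := Num.max B0 (ergodicity_constant C rho th).
have M_gt0 : 0 < M by rewrite /M lt_max ltr01 orbT.
have fM y : `|f y| <= M by rewrite /M le_max fM0.
have B_gt1 : 1 < B.
  by rewrite /B lt_max ergodicity_constant_gt1 ?orbT//; case: (ergP th).
have thB : ergodicity_constant C rho th <= B by rewrite /B le_max lexx orbT.
pose x : X := point.
have rate0 : M * (B * (1 - B^-1) ^+ k * V x) @[k --> \oo] --> (0 : R).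
  have -> : (fun k => M * (B * (1 - B^-1) ^+ k * V x)) =
      geometric (M * B * V x) (1 - B^-1).
    by apply/funext => k /=; rewrite mulrAC mulrA (mulrA M).
  apply: cvg_geometric; have B_gt0 := lt_trans ltr01 B_gt1.
  rewrite ger0_norm ?gtrBl ?invr_gt0// subr_ge0 invf_le1// ltW//.
apply/cvgrPdist_lt => e e0; have e30 : 0 < e / 3 by rewrite divr_gt0.
(* [k] is fixed here, uniformly in [n]. *)
have [k _ /(_ k (leqnn k)) hk] := (cvgrPdist_lt _ _).1 rate0 _ e30.
have kcvg := (cvgrPdist_lt _ _).1 (iter_kernel_cvg eP Pu (k := k) cbf (x := x)) _ e30.
have {}hk : M * (B * (1 - B^-1) ^+ k * V x) < e / 3.
  by apply: le_lt_trans hk; rewrite sub0r normrN ler_norm.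
near=> n.
have unB : ergodicity_constant C rho (u n) <= B.
  by rewrite /B le_max; apply/orP; left; near: n.
have kn : `|iter k (kernel_act (P th)) f x -
    iter k (kernel_act (P (u n))) f x| < e / 3 by near: n; exact: kcvg.
have := iter_kernel_invariant_dist k x thB mf M_gt0 fM.
have := iter_kernel_invariant_dist k x unB mf M_gt0 fM.
move=> /le_lt_trans/(_ hk) + /le_lt_trans/(_ hk).
move: kn; rewrite !ltr_norml => /andP[? ?] /andP[? ?] /andP[? ?]; lra.
Unshelve. all: by end_near. Qed.

End invariant_laws.

Unset Implicit Arguments.

Theorem theorem2p11 (R : realType) (X : ptopologicalType)
    (HX : polish_space R X)
    (dT : measure_display) (Theta : measurableType dT)
    (pi : probability (borel X) R)
    (P : Theta -> R.-pker (borel X) ~> (borel X))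
    (dO : measure_display) (Om : measurableType dO) (Pr : probability Om R)
    (F : nat -> set (set Om))
    (Xn : nat -> Om -> borel X) (theta : nat -> Om -> Theta)
    (Hproc : adaptive_process P Pr F Xn theta)
    (V : borel X -> R) (b delta lambda : Theta -> R)
    (nu : Theta -> probability (borel X) R)
    (HA3 : drift_minorization P pi V b delta lambda nu)
    (pi_ : Theta -> probability (borel X) R)
    (Hpi : forall th, invariant_measure (P th) (pi_ th))
    (C rho : Theta -> R)
    (Hergo : geometric_ergodicity P V pi_ C rho)
    (Hi : {ae Pr, forall w,
       (limn_esup (fun n => (ergodicity_constant C rho (theta n w))%:E)
          < +oo)%E})
    (Hii : forall f : X -> R, continuous f -> bounded_fun f ->
       equicontinuous [set: Theta]
         (fun th => kernel_act (P th) f : X -> R))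
    (theta_star : Theta)
    (Hiii : forall x : X, exists Om_x : set Om, full_set Pr Om_x /\
       forall w, Om_x w ->
         cvg_weakly (fun n => P (theta n w) x) (P theta_star x)) :
  exists Om_0 : set Om, full_set Pr Om_0 /\
    forall w, Om_0 w ->
      forall f : X -> R, continuous f -> bounded_fun f ->
        (fun n => Rintegral (pi_ (theta n w)) setT f) @ \oo -->
          Rintegral (pi_ theta_star) setT f.
Proof.
have [[D cD dD] _] := HX; have [_ V1 _] := HA3.
have eP (f : X -> R) : bounded_continuous f ->
    equicontinuous [set: Theta] (fun th => kernel_act (P th) f : X -> R).
  by move=> [cf bf]; exact: Hii.
have aeD : {ae Pr, forall w (x : X), D x ->
    cvg_weakly (fun n => P (theta n w) x) (P theta_star x)}.
  apply: ae_countable => // x _; have [Om_x [fullx cvgx]] := Hiii x.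
  exact: filterS cvgx (full_set_ae fullx).
have [Om0 fullOm0 Om0P] := ae_full_set (filterI Hi aeD).
exists Om0; split => // w /Om0P[limL cvgD].
apply: (invariant_cvg_weakly V1 Hergo (u := theta ^~ w)) => // f cbf.
apply: (@equicontinuous_cvg_dense R X Theta (fun th => kernel_act (P th) f)
  (theta ^~ w) theta_star D (eP f cbf) dD).
by move=> x Dx; have [cf bf] := cbf; exact: cvgD x Dx f cf bf.
Qed.
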